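(* For every integer $p\geq 2$, the tricomplex Multibrot set $\mathcal{M}_3^p$ is a connected subset of $\mathbb{M}(3)\cong\mathbb{R}^8$.
   Context: The tricomplex numbers $\mathbb{M}(3)$ form the commutative real algebra generated by commuting units $\mathbf{i_1},\mathbf{i_2},\mathbf{i_3}$ with $\mathbf{i_k}^2=-1$; set $\mathbf{j_1}=\mathbf{i_1}\mathbf{i_2}$, $\mathbf{j_2}=\mathbf{i_1}\mathbf{i_3}$, $\mathbf{j_3}=\mathbf{i_2}\mathbf{i_3}$, $\mathbf{i_4}=\mathbf{i_1}\mathbf{i_2}\mathbf{i_3}$. It has real basis $1,\mathbf{i_1},\mathbf{i_2},\mathbf{i_3},\mathbf{i_4},\mathbf{j_1},\mathbf{j_2},\mathbf{j_3}$, identified with $\mathbb{R}^8$, with the Euclidean norm $\|\cdot\|_3$. For $c\in\mathbb{M}(3)$, $Q_{p,c}(\eta)=\eta^p+c$, $Q_{p,c}^m$ its $m$-fold iterate, and $\mathcal{M}_3^p=\{c\in\mathbb{M}(3) : (Q_{p,c}^m(0))_{m\geq1}\text{ is bounded}\}$. *)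

(* Defs.v *)
From Stdlib Require Import Reals.
Open Scope R_scope.

(* Commutative "doubling": from an algebra A build A[i]/(i^2+1) as A*A,
   (x1 + x2 i)(y1 + y2 i) = (x1 y1 - x2 y2) + (x1 y2 + x2 y1) i. *)
Definition dadd {A : Type} (add : A -> A -> A) (x y : A * A) : A * A :=
  (add (fst x) (fst y), add (snd x) (snd y)).
Definition dmul {A : Type} (add mul : A -> A -> A) (opp : A -> A)
  (x y : A * A) : A * A :=
  (add (mul (fst x) (fst y)) (opp (mul (snd x) (snd y))),
   add (mul (fst x) (snd y)) (mul (snd x) (fst y))).
Definition dopp {A : Type} (opp : A -> A) (x : A * A) : A * A :=
  (opp (fst x), opp (snd x)).
Definition dnorm2 {A : Type} (n2 : A -> R) (x : A * A) : R :=
  n2 (fst x) + n2 (snd x).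

Definition Cx := (R * R)%type.
Definition cadd : Cx -> Cx -> Cx := dadd Rplus.
Definition cmul : Cx -> Cx -> Cx := dmul Rplus Rmult Ropp.
Definition copp : Cx -> Cx := dopp Ropp.
Definition cnorm2 : Cx -> R := dnorm2 (fun r => r * r).

Definition BC := (Cx * Cx)%type.
Definition bcadd : BC -> BC -> BC := dadd cadd.
Definition bcmul : BC -> BC -> BC := dmul cadd cmul copp.
Definition bcopp : BC -> BC := dopp copp.
Definition bcnorm2 : BC -> R := dnorm2 cnorm2.

(* tricomplex numbers M(3) = M(2)[i3]; an element
   ((a0 + a1 i1) + (a2 + a3 i1) i2) + ((a4 + a5 i1) + (a6 + a7 i1) i2) i3
   has coordinates on the basis 1, i1, i2, j1=i1i2, i3, j2=i1i3, j3=i2i3,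
   i4=i1i2i3, so this is exactly the identification M(3) = R^8. *)
Definition TC := (BC * BC)%type.
Definition tcadd : TC -> TC -> TC := dadd bcadd.
Definition tcmul : TC -> TC -> TC := dmul bcadd bcmul bcopp.
Definition tcopp : TC -> TC := dopp bcopp.
Definition tc0 : TC := (((0, 0), (0, 0)), ((0, 0), (0, 0))).
Definition tc1 : TC := (((1, 0), (0, 0)), ((0, 0), (0, 0))).

Definition tcnorm (x : TC) : R := sqrt (dnorm2 bcnorm2 x).
Definition tcdist (x y : TC) : R := tcnorm (tcadd x (tcopp y)).

Fixpoint tcpow (x : TC) (n : nat) : TC :=
  match n with
  | O => tc1
  | S k => tcmul x (tcpow x k)
  end.

Definition Q (p : nat) (c : TC) (eta : TC) : TC := tcadd (tcpow eta p) c.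

Fixpoint Qiter (p : nat) (c : TC) (m : nat) : TC :=
  match m with
  | O => tc0
  | S k => Q p c (Qiter p c k)
  end.

Definition Multibrot3 (p : nat) (c : TC) : Prop :=
  exists M : R, forall m : nat, (1 <= m)%nat -> tcnorm (Qiter p c m) <= M.

Definition tc_open (U : TC -> Prop) : Prop :=
  forall x, U x -> exists eps, 0 < eps /\ forall y, tcdist y x < eps -> U y.

Definition tc_connected (S : TC -> Prop) : Prop :=
  ~ exists U V : TC -> Prop,
      tc_open U /\ tc_open V /\
      (forall x, S x -> U x \/ V x) /\
      (exists x, S x /\ U x) /\ (exists x, S x /\ V x) /\
      (forall x, S x -> U x -> V x -> False).

(* Main.v *)
(* Sending i1, i2, i3 to i, +-i, +-i gives four ring morphisms from M(3) to C which identify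
   M(3) with C^4 and the tricomplex Multibrot set with the fourth power of the complex one,
   so it suffices that the complex Multibrot set is connected.  That set is the decreasing
   intersection of the compact sets {|P_n| <= 8}, where P_n(c) is the n-th iterate of 0
   under z^d + c, and each of these is connected in the sense of small chains.

   For the latter let N = d^(n-1) be the degree of P_n.  If |P_n(c)| = 8 the critical values
   of the (n-1)-st iterate f_c of z^d + c have modulus at most 4 while
   |f_c(c)| = |P_n(c)| = 8, so c can be pushed to infinity along a ray, which singles out
   an N-th root of P_n(c) depending continuously on c.  Following P_n(c) around the circle
   of radius 8 turns this root by 1/N of a turn each time, so that N turns are needed to
   come back: all the N solutions of P_n(c) = 8 lie on one chain.  Every point of
   {|P_n| <= 8} is joined to one of them by lifting a segment.  Lifting only uses that a
   monic polynomial with a small value at z has a root near z. *)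

Require Import Defs.
From mathcomp Require Import all_boot all_order all_algebra.
From mathcomp Require Import boolp reals Rstruct topology normedtype sequences.
From mathcomp Require Import cyclic separable cyclotomic complex ring lra.
Set Implicit Arguments.
Unset Strict Implicit.
Unset Printing Implicit Defensive.
Import Order.TTheory GRing.Theory Num.Theory Normc.
Import numFieldNormedType.Exports.
Local Open Scope ring_scope.

(** * Moduli of complex numbers; roots of monic polynomials and of unity *)

Section ComplexNorm.
Variable R : rcfType.
Implicit Types x y z : R[i].

Lemma normc_ge0 x : 0 <= normc x.
Proof. by case: x => a b; exact: sqrtr_ge0. Qed.

Lemma normcD x y : normc (x + y) <= normc x + normc y.
Proof. exact: le_normcD. Qed.

Lemma normcBC x y : normc (x - y) = normc (y - x).
Proof. by rewrite -opprB; exact: normcN. Qed.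

Lemma normc_dist x y z : normc (x - z) <= normc (x - y) + normc (y - z).
Proof. by rewrite (_ : x - z = (x - y) + (y - z)); [exact: normcD | ring]. Qed.

Lemma normc_le_dist x y : normc x <= normc y + normc (x - y).
Proof. by rewrite {1}(_ : x = y + (x - y)); [exact: normcD | ring]. Qed.

Lemma normc0E : normc (0 : R[i]) = 0.
Proof. exact: normc0. Qed.

Lemma normc1E : normc (1 : R[i]) = 1.
Proof. exact: normc1. Qed.

Lemma normc_eq0 x : (normc x == 0) = (x == 0).
Proof. by apply/eqP/eqP => [/eq0_normc|->] //; exact: normc0E. Qed.

Lemma normc_gt0 x : (0 < normc x) = (x != 0).
Proof. by rewrite lt_def normc_eq0 normc_ge0 andbT. Qed.

Lemma normcX x n : normc (x ^+ n) = normc x ^+ n.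
Proof.
elim: n => [|n IH]; first by rewrite !expr0 normc1E.
by rewrite !exprS normcM IH.
Qed.

Lemma normcR (r : R) : normc (r%:C)%C = `|r|.
Proof. by rewrite /normc /= expr0n addr0 sqrtr_sqr. Qed.

Lemma normc_nat n : normc (n%:R : R[i]) = n%:R.
Proof. by rewrite -(rmorph_nat (real_complex R)) normcR ger0_norm. Qed.

Lemma normc_prod (s : seq R[i]) (f : R[i] -> R[i]) :
  normc (\prod_(i <- s) f i) = \prod_(i <- s) normc (f i).
Proof.
elim: s => [|a s IH]; first by rewrite !big_nil normc1E.
by rewrite !big_cons normcM IH.
Qed.

(** [p - v] splits into [N] linear factors; if all its roots were at distance at least [e] from [z],
    its value at [z] would have modulus at least [e ^+ N]. *)
Lemma monic_root_near (p : {poly R[i]}) (N : nat) (z v : R[i]) (e : R) :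
  p \is monic -> size p = N.+1 -> (0 < N)%N -> 0 <= e ->
  normc (p.[z] - v) < e ^+ N ->
  exists z', p.[z'] = v /\ normc (z - z') < e.
Proof.
move=> mp sp N0 e0 h.
have sv : (size (- v%:P)%R < size p)%N.
  by rewrite size_polyN sp ltnS (leq_trans (size_polyC_leq1 _)).
have mq : p - v%:P \is monic by rewrite monicE lead_coefDl // -monicE.
have sq : size (p - v%:P) = N.+1 by rewrite size_polyDl.
have [r rE] := closed_field_poly_normal (p - v%:P).
move: rE; rewrite (monicP mq) scale1r => rE.
have sr : size r = N.
  by move: sq; rewrite rE size_prod_XsubC => -[].
have hz y : p.[y] - v = \prod_(x <- r) (y - x).
  rewrite -[LHS]/(p.[y] + - v) -(hornerC v y) -hornerN -hornerD rE horner_prod.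
  by apply: eq_bigr => i _; rewrite hornerXsubC.
have [[x xr hx]|no] := pselect (exists2 x, x \in r & normc (z - x) < e).
  exists x; split => //; apply/eqP; rewrite -subr_eq0 hz.
  by rewrite prodf_seq_eq0; apply/hasP; exists x => //=; rewrite subrr.
exfalso; move: h; rewrite hz normc_prod -sr ltNge => /negP; apply.
elim: (r) no => [|a s IH] no; first by rewrite big_nil expr0.
rewrite big_cons exprS ler_pM ?exprn_ge0 //.
  rewrite leNgt; apply/negP => ha; apply: no; exists a => //; exact: mem_head.
by apply: IH => -[x xs hx]; apply: no; exists x => //; rewrite inE xs orbT.
Qed.

Lemma normc_root1 x n : (0 < n)%N -> x ^+ n = 1 -> normc x = 1.
Proof.
move=> n0 h; apply/eqP; rewrite -(@eqrXn2 _ n) ?normc_ge0 //.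
by rewrite -normcX h normc1E expr1n.
Qed.

Lemma normc_Xsub1 x n : normc x = 1 -> normc (x ^+ n - 1) <= n%:R * normc (x - 1).
Proof.
move=> x1; elim: n => [|n IH]; first by rewrite expr0 subrr normc0E mul0r.
rewrite (_ : x ^+ n.+1 - 1 = x * (x ^+ n - 1) + (x - 1)); last by rewrite exprS; ring.
by apply: (le_trans (normcD _ _)); rewrite normcM x1 mul1r -natr1 mulrDl mul1r lerD2r.
Qed.

(** If [x] is not 1, the powers [x ^+ i] with [i < n] sum to 0; but each is within
    [n * normc (x - 1) < 1] of 1, so their sum is at distance less than [n] from [n]. *)
Lemma unity_root_near1 x n : (0 < n)%N -> x ^+ n = 1 ->
  normc (x - 1) < n%:R^-1 -> x = 1.
Proof.
move=> n0 xn h; have x1 := normc_root1 n0 xn.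
have n0R : 0 < n%:R :> R by rewrite ltr0n.
apply/eqP; rewrite -subr_eq0; apply/negPn/negP => xn0.
have : (x - 1) * (\sum_(i < n) x ^+ i) = 0 by rewrite -subrX1 xn subrr.
move/eqP; rewrite mulf_eq0 (negbTE xn0) /= => /eqP s0.
have : normc (\sum_(i < n) x ^+ i - n%:R) <= \sum_(i < n) (n%:R * normc (x - 1)).
  rewrite (_ : n%:R = \sum_(i < n) 1 :> R[i]); last by rewrite sumr_const card_ord.
  rewrite -sumrB.
  elim/big_ind2: _ => [|a b c d ab cd|i _]; first by rewrite normc0E.
    by apply: (le_trans (normcD _ _)); exact: lerD.
  apply: (le_trans (normc_Xsub1 i x1)).
  by rewrite ler_wpM2r ?normc_ge0 // ler_nat ltnW.
rewrite s0 sub0r normcN normc_nat sumr_const card_ord -[X in _ <= X]mulr_natr.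
rewrite -{1}[n%:R]mulr1 -mulrA ler_pM2l // leNgt => /negP; apply.
by rewrite -(ltr_pM2r (x := n%:R^-1)) ?invr_gt0 // mulfK ?gt_eqF // mul1r.
Qed.

Lemma normc_le_ReIm z : normc z <= `|complex.Re z| + `|complex.Im z|.
Proof.
case: z => a b /=; rewrite -(@ler_pXn2r _ 2) ?nnegrE ?sqrtr_ge0 ?addr_ge0 //.
rewrite sqr_sqrtr ?addr_ge0 ?sqr_ge0 // sqrrD -[a ^+ 2]real_normK ?num_real //.
rewrite -[b ^+ 2]real_normK ?num_real // -addrA lerD2l lerDr.
by rewrite mulrn_wge0 // mulr_ge0.
Qed.

Lemma normc_ge_Re_Im z : `|complex.Re z| <= normc z /\ `|complex.Im z| <= normc z.
Proof.
case: z => a b /=; split; rewrite -sqrtr_sqr ler_sqrt ?addr_ge0 ?sqr_ge0 //.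
  by rewrite lerDl sqr_ge0.
by rewrite lerDr sqr_ge0.
Qed.

End ComplexNorm.

(** * Iterates of [z ^+ d + c]: polynomial form, Lipschitz bounds, escape estimates *)

Section Iterates.
Variables (R : realType) (d : nat).
Hypothesis d2 : (2 <= d)%N.
Implicit Types (c z w : R[i]) (k n j : nat) (p g : {poly R[i]}).

Definition fit c k z : R[i] := iter k (fun w => w ^+ d + c) z.

Lemma fitS c k z : fit c k.+1 z = fit c k z ^+ d + c.
Proof. by []. Qed.

Lemma fitSr c k z : fit c k.+1 z = fit c k (z ^+ d + c).
Proof. exact: iterSr. Qed.

Lemma fit0S c k : fit c k.+1 0 = fit c k c.
Proof. by rewrite fitSr expr0n; case: (d) d2 => //= m _; rewrite add0r. Qed.

(** The iterate as a polynomial in [z], then the orbit of the critical value [c] as polynomials in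
    [c]. Starting the latter at ['X] rather than 0 makes both monic of degree [d ^ k]. *)
Definition zpoly c k : {poly R[i]} := iter k (fun g => g ^+ d + c%:P) 'X.
Definition cpoly k : {poly R[i]} := iter k (fun g => g ^+ d + 'X) 'X.

Lemma horner_zpoly c k z : (zpoly c k).[z] = fit c k z.
Proof. by elim: k => [|k IH] /=; rewrite ?hornerX // hornerD horner_exp IH hornerC. Qed.

Lemma horner_cpoly k c : (cpoly k).[c] = fit c k c.
Proof. by elim: k => [|k IH] /=; rewrite ?hornerX // hornerD horner_exp IH hornerX. Qed.

Lemma monic_step g p n : (0 < n)%N -> g \is monic -> size g = n.+1 ->
  (size p <= 2)%N ->
  (g ^+ d + p \is monic) * (size (g ^+ d + p) = (n * d).+1).
Proof.
move=> n0 mg sg sp.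
have sgd : size (g ^+ d) = (n * d).+1.
  rewrite -(prednK (n := size (g ^+ d))) ?size_exp ?sg //.
  by rewrite size_poly_gt0 monic_neq0 // monic_exp.
have lt : (size p < size (g ^+ d)%R)%N.
  by rewrite sgd ltnS (leq_trans sp) // (leq_trans d2) // leq_pmull.
by rewrite monicE lead_coefDl // -monicE monic_exp // size_polyDl // sgd.
Qed.

Lemma zpoly_monic c k : (zpoly c k \is monic) * (size (zpoly c k) = (d ^ k).+1).
Proof.
elim: k => [|k [IH1 IH2]]; first by rewrite /= monicX size_polyX.
rewrite expnSr; apply: monic_step => //; first by rewrite expn_gt0 (ltnW d2).
by rewrite (leq_trans (size_polyC_leq1 _)).
Qed.

Lemma cpoly_monic k : (cpoly k \is monic) * (size (cpoly k) = (d ^ k).+1).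
Proof.
elim: k => [|k [IH1 IH2]]; first by rewrite /= monicX size_polyX.
rewrite expnSr; apply: monic_step => //; first by rewrite expn_gt0 (ltnW d2).
by rewrite size_polyX.
Qed.

Lemma expr_lipschitz n (B : R) : 0 <= B -> exists2 L : R, 0 <= L &
  forall z w, normc z <= B -> normc w <= B ->
    normc (z ^+ n - w ^+ n) <= L * normc (z - w).
Proof.
move=> B0; elim: n => [|n [L L0 IH]].
  by exists 0 => // z w _ _; rewrite !expr0 subrr normc0E mul0r.
exists (B * L + B ^+ n); first by rewrite addr_ge0 ?mulr_ge0 ?exprn_ge0.
move=> z w hz hw.
rewrite (_ : _ - _ = z * (z ^+ n - w ^+ n) + (z - w) * w ^+ n); last first.
  by rewrite !exprS; ring.
apply: (le_trans (normcD _ _)); rewrite [X in _ <= X]mulrDl !normcM -mulrA.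
apply: lerD; first by apply: ler_pM; rewrite ?normc_ge0 ?IH.
rewrite mulrC ler_wpM2r ?normc_ge0 // normcX.
by rewrite lerXn2r // nnegrE normc_ge0.
Qed.

Lemma fit_bounded k (B : R) : 0 <= B -> exists2 M : R, 0 <= M &
  forall c z, normc c <= B -> normc z <= B -> normc (fit c k z) <= M.
Proof.
move=> B0; elim: k => [|k [M M0 IH]]; first by exists B.
exists (M ^+ d + B); first by rewrite addr_ge0 ?exprn_ge0.
move=> c z hc hz; rewrite fitS; apply: (le_trans (normcD _ _)); apply: lerD => //.
by rewrite normcX lerXn2r ?nnegrE ?normc_ge0 ?IH.
Qed.

Lemma fit_lipschitz k (B : R) : 0 <= B -> exists2 L : R, 0 <= L &
  forall c c' z z', normc c <= B -> normc c' <= B -> normc z <= B -> normc z' <= B ->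
    normc (fit c k z - fit c' k z') <= L * (normc (c - c') + normc (z - z')).
Proof.
move=> B0; elim: k => [|k [L L0 IH]].
  by exists 1 => // c c' z z' _ _ _ _; rewrite mul1r /= lerDr normc_ge0.
have [M M0 hM] := fit_bounded k B0.
have [K K0 hK] := expr_lipschitz d M0.
exists (K * L + 1); first by rewrite addr_ge0 ?mulr_ge0.
move=> c c' z z' hc hc' hz hz'; rewrite !fitS.
rewrite (_ : _ - _ = (fit c k z ^+ d - fit c' k z' ^+ d) + (c - c')); last by ring.
apply: (le_trans (normcD _ _)); rewrite mulrDl; apply: lerD; last first.
  by rewrite mul1r lerDl normc_ge0.
apply: (le_trans (hK _ _ _ _)); rewrite ?hM // -mulrA ler_wpM2l //.
exact: IH.
Qed.

Lemma expr_ge_sqr (a : R) : 1 <= a -> a ^+ 2 <= a ^+ d.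
Proof. by move=> a1; rewrite ler_weXn2l. Qed.

Lemma normc_fit_ge c z k : normc c <= 4 -> 5 <= normc z -> normc z <= normc (fit c k z).
Proof.
move=> hc hz; elim: k => [|k IH] //; rewrite fitS; apply: (le_trans IH).
have a5 := le_trans hz IH; set w := fit c k z in a5 *.
have h := normc_le_dist (w ^+ d) (w ^+ d + c).
have e1 : normc (w ^+ d - (w ^+ d + c)) = normc c.
  by rewrite (_ : _ - _ = - c); [exact: normcN | ring].
rewrite e1 normcX in h.
have : normc w ^+ 2 <= normc w ^+ d by apply: expr_ge_sqr; lra.
rewrite expr2; nra.
Qed.

Lemma fit_bounded_arg c z k (B : R) : normc c <= 4 -> 5 <= B ->
  normc (fit c k z) <= B -> normc z <= B.
Proof.
move=> hc hB h; have [z5|z5] := lerP 5 (normc z); last by lra.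
exact: (le_trans (normc_fit_ge k hc z5)).
Qed.

(** Here [normc w ^+ d >= 4 * normc w], and adding [c] costs at most [normc w]. *)
Lemma critical_orbit_growth c n : 4 <= normc (fit c n 0) ->
  normc c <= normc (fit c n 0) -> 3 * normc (fit c n 0) <= normc (fit c n.+1 0).
Proof.
rewrite fitS; set w := fit c n 0 => a4 ha.
have h := normc_le_dist (w ^+ d) (w ^+ d + c).
have e1 : normc (w ^+ d - (w ^+ d + c)) = normc c.
  by rewrite (_ : _ - _ = - c); [exact: normcN | ring].
rewrite e1 normcX in h.
have : normc w ^+ 2 <= normc w ^+ d by apply: expr_ge_sqr; lra.
rewrite expr2; nra.
Qed.

Lemma critical_orbit_escape_from c n i : 4 <= normc (fit c n 0) ->
  normc c <= normc (fit c n 0) -> 3 ^+ i * normc (fit c n 0) <= normc (fit c (n + i) 0).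
Proof.
move=> h4 hc; elim: i => [|i IH]; first by rewrite expr0 mul1r addn0.
have e1 : 1 <= 3 ^+ i :> R by rewrite exprn_ege1 // ler1n.
have ge : normc (fit c n 0) <= normc (fit c (n + i) 0).
  by apply: le_trans IH; rewrite ler_peMl ?normc_ge0.
rewrite addnS; apply: le_trans (critical_orbit_growth _ _); rewrite ?exprS.
- by rewrite -mulrA ler_pM2l // ltr0n.
- exact: le_trans ge.
- exact: le_trans ge.
Qed.

Lemma critical_orbit_escape c n i : (0 < n)%N -> 4 < normc (fit c n 0) ->
  3 ^+ i * 4 <= normc (fit c (n + i) 0).
Proof.
move=> n0 h4; have hc : normc c <= normc (fit c n 0).
  (* If [c] has modulus above 4, growth starts at the first iterate, which is [c] itself. *)
  have [c4|c4] := lerP (normc c) 4; first by lra.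
  have e : fit c 1 0 = c by rewrite fit0S.
  have := @critical_orbit_escape_from c 1 n.-1; rewrite e add1n prednK //.
  move=> /(_ (ltW c4) (lexx _)); apply: le_trans.
  by rewrite ler_peMl ?normc_ge0 // exprn_ege1 // ler1n.
apply: le_trans (critical_orbit_escape_from i _ hc); last by lra.
by rewrite ler_wpM2l ?exprn_ge0 // ltW.
Qed.

(** Modulus above 4 at time [j] would force modulus at least 12 at time [n]. *)
Lemma critical_orbit_le4 c n j : (0 < j < n)%N -> normc (fit c n 0) <= 8 ->
  normc (fit c j 0) <= 4.
Proof.
move=> /andP[j0 jn] h8; rewrite leNgt; apply/negP => h4.
have := critical_orbit_escape (n - j) j0 h4; rewrite subnKC; last exact: ltnW.
have : 3 <= 3 ^+ (n - j) :> R.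
  by rewrite -{1}[3]expr1 ler_weXn2l ?ler1n // subn_gt0.
lra.
Qed.

Lemma critical_orbit_param_le4 c k : (0 < k)%N -> normc (fit c k.+1 0) <= 8 ->
  normc c <= 4.
Proof.
move=> k0 h; have <- : fit c 1 0 = c by rewrite fit0S.
exact: critical_orbit_le4 h.
Qed.

Lemma critical_orbit_bounded c (M : R) : (forall n, normc (fit c n 0) <= M) ->
  forall n, normc (fit c n 0) <= 4.
Proof.
move=> hM [|n]; first by rewrite normc0E.
rewrite leNgt; apply/negP => h4.
have h i : i%:R <= M.
  apply: le_trans (hM (n.+1 + i)%N); apply: le_trans (critical_orbit_escape i _ h4) => //.
  have : i%:R <= 3 ^+ i :> R by rewrite -natrX ler_nat ltnW // ltn_expl.
  have : 0 <= 3 ^+ i :> R by rewrite exprn_ge0.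
  lra.
have M0 : 0 <= M by apply: le_trans (hM 0%N); exact: normc_ge0.
have := archi_boundP M0; rewrite ltNge; apply/negP; rewrite negbK; exact: h.
Qed.

(** In the induction, the quotient [w / y] of the iterate by [z ^+ N] is within [A / normc z] of 1,
    and the power [d] is Lipschitz on bounded discs. *)
Lemma fit_asymptotic k : exists2 A : R, 0 <= A &
  forall c z, normc c <= 4 -> 1 <= normc z ->
    normc (fit c k z - z ^+ (d ^ k)) <= A * normc z ^+ (d ^ k).-1.
Proof.
elim: k => [|k [A A0 IH]].
  by exists 0 => // c z _ _; rewrite expn0 expr1 subrr normc0E mul0r.
have A1 : 0 <= A + 1 by lra.
have [L L0 hL] := expr_lipschitz d A1.
have N0 : (0 < d ^ k)%N by rewrite expn_gt0 (ltnW d2).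
exists (L * A + 4); first by rewrite addr_ge0 // mulr_ge0.
move=> c z hc z1; rewrite fitS.
set N := (d ^ k)%N in IH N0 *; set w := fit c k z in IH *; set a := normc z.
have a0 : 0 < a by apply: lt_le_trans z1.
have hw := IH c z hc z1; rewrite -/w -/a in hw.
have aN : a ^+ N = a * a ^+ N.-1 by rewrite -exprS prednK.
pose y := z ^+ N.
have ny : normc y = a ^+ N by rewrite /y normcX.
have y0 : y != 0 by rewrite -normc_gt0 ny exprn_gt0.
have yN0 : 0 < normc y by rewrite normc_gt0.
have h1 : normc (w / y - 1) <= A / a.
  have -> : w / y - 1 = (w - y) / y by rewrite mulrBl mulfV.
  rewrite normcM normcV ler_pdivrMr // ny aN [A / a * _]mulrA divfK ?gt_eqF //.
have Aa : A / a <= A by rewrite ler_pdivrMr // ler_peMr.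
have h2 : normc (w / y) <= A + 1.
  have := normc_le_dist (w / y) 1; rewrite normc1E; lra.
have h3 : normc (1 : R[i]) <= A + 1 by rewrite normc1E; lra.
have := hL _ _ h2 h3; rewrite expr1n => h4.
rewrite expnSr exprM -/y.
have -> : w ^+ d + c - y ^+ d = ((w / y) ^+ d - 1) * y ^+ d + c.
  rewrite mulrBl mul1r expr_div_n divfK; first by ring.
  exact: expf_neq0.
apply: (le_trans (normcD _ _)); rewrite normcM normcX ny -exprM -/N.
have NE : (N * d)%N = (N * d).-1.+1 by rewrite prednK // muln_gt0 N0 (ltnW d2).
rewrite [X in a ^+ X]NE exprS mulrDl; apply: lerD.
  rewrite mulrA ler_wpM2r ?exprn_ge0 ?(ltW a0) //.
  rewrite -(ler_pdivlMr _ _ a0); apply: (le_trans h4).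
  by rewrite -mulrA ler_wpM2l.
by apply: (le_trans hc); rewrite ler_peMr // exprn_ege1.
Qed.

End Iterates.

(** * Pushing points outwards in the dynamical plane *)

Section PushOut.
Variables (R : realType) (d : nat).
Hypothesis d2 : (2 <= d)%N.
Implicit Types (c z w : R[i]) (k n j : nat).
Local Notation fit := (fit d).

(* Critical values of [fit c k] are among the [fit c j 0], hence of modulus at most 4:
   away from them the map is injective on small discs of uniform size. *)
Lemma fit_locally_injective k (B : R) : 4 <= B -> exists2 eta : R, 0 < eta &
  forall c z z', (forall j, (j <= k)%N -> normc (fit c j 0) <= 4) -> normc c <= 4 ->
    normc z <= B -> normc z' <= B -> 6 <= normc (fit c k z) ->
    fit c k z = fit c k z' -> normc (z - z') < eta -> z = z'.
Proof.
elim: k B => [|k IH] B B4; first by exists 1.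
have B0 : 0 <= B by lra.
have [M M0 hM] := fit_bounded d 1 B0.
have [|eta' e0 he] := IH (M + 4); first by lra.
have [L L0 hL] := expr_lipschitz d B0.
have [K K0 hK] := fit_lipschitz d k.+1 B0.
have d0 : 0 < d%:R :> R by rewrite ltr0n (ltnW d2).
pose rho := 2 / (K + 1).
have K1 : 0 < K + 1 by lra.
have L1 : 0 < L + 1 by lra.
have rho0 : 0 < rho by rewrite divr_gt0.
exists (Num.min (eta' / (L + 1)) (rho / d%:R)); first by rewrite lt_min !divr_gt0.
move=> c z z' hc c4 hz hz' h6 hf; rewrite lt_min => /andP[h1 h2].
(* The values at [z] and at the critical point 0 have moduli at least 6 and at most 4, so the
   Lipschitz bound keeps [z] away from 0. *)
have z_big : rho <= normc z.
  have := hK c c z 0 (le_trans c4 B4) (le_trans c4 B4) hz.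
  rewrite normc0E => /(_ B0); rewrite !subr0 subrr normc0E add0r => hh.
  have := normc_le_dist (fit c k.+1 z) (fit c k.+1 0).
  have := hc _ (leqnn k.+1) => h4 h5.
  rewrite /rho ler_pdivrMr //; have := normc_ge0 z; nra.
have zn0 : z != 0 by rewrite -normc_gt0; apply: lt_le_trans z_big.
have ezz : z ^+ d = z' ^+ d.
  apply: (addIr c); apply: (he c) => //.
  - by move=> j jk; apply: hc; exact: leqW.
  - by have := hM c z (le_trans c4 B4) hz => /= h; lra.
  - by have := hM c z' (le_trans c4 B4) hz' => /= h; lra.
  - by rewrite -fitSr.
  - by rewrite -!fitSr.
  rewrite (_ : _ - _ = z ^+ d - z' ^+ d); last by ring.
  apply: le_lt_trans (hL _ _ hz hz') _.
  move: h1; rewrite ltr_pdivlMr //; have := normc_ge0 (z - z'); nra.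
have : z' / z = 1.
  apply: (@unity_root_near1 _ _ d); first exact: ltnW d2.
    by rewrite expr_div_n -ezz divff // expf_neq0.
  have -> : z' / z - 1 = (z' - z) / z by rewrite mulrBl divff.
  rewrite normcM normcV normcBC ltr_pdivrMr ?normc_gt0 //.
  apply: (lt_le_trans h2); rewrite mulrC ler_pM2l ?invr_gt0 //.
by move/(congr1 (fun x => x * z)); rewrite divfK // mul1r => ->.
Qed.

Definition unif_cont_on (A : R[i] -> Prop) (D : R[i] -> R[i]) :=
  forall e : R, 0 < e -> exists2 r : R, 0 < r &
    forall c c', A c -> A c' -> normc (c - c') < r -> normc (D c - D c') < e.

(* [D c] is where [z = c] ends when [fit c k z] is pushed outwards along a ray,
   in the dynamical plane of [c], until its modulus is multiplied by [T]. *)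
Lemma push_out k (T : R) : (0 < k)%N -> 1 <= T ->
  let A c := normc (fit c k.+1 0) = 8 in
  exists2 D : R[i] -> R[i], unif_cont_on A D &
    forall c, A c -> fit c k (D c) = (T%:C)%C * fit c k.+1 0.
Proof.
move=> k0 T1 A.
have Ale c j : A c -> (j <= k)%N -> normc (fit c j 0) <= 4.
  move=> Ac jk; case: j jk => [|j] jk; first by rewrite normc0E.
  by apply: (critical_orbit_le4 d2 (n := k.+1)); rewrite ?Ac.
have Ac4 c : A c -> normc c <= 4.
  by move=> Ac; apply: (critical_orbit_param_le4 d2 k0); rewrite Ac.
(* All targets have modulus at most [8 * T], so their preimages stay within [B]; 5 is the threshold
   of [fit_bounded_arg]. *)
pose B := 8 * T + 5.
have B4 : 4 <= B by rewrite /B; lra.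
have B0 : 0 <= B by lra.
have [eta eta0 hinj] := fit_locally_injective k B4.
have [L L0 hL] := fit_lipschitz d k B0.
pose N := (d ^ k)%N.
have N0 : (0 < N)%N by rewrite expn_gt0 (ltnW d2).
have root_near c z v e : 0 <= e -> normc (fit c k z - v) < e ^+ N ->
    exists z', fit c k z' = v /\ normc (z - z') < e.
  move=> e0 h; have [mz sz] := zpoly_monic d2 c k.
  have [|z' [z'1 z'2]] := @monic_root_near _ _ N z v e mz sz N0 e0.
    by rewrite horner_zpoly.
  by exists z'; rewrite -horner_zpoly.
(* Continuation in [l]: [G 1] holds with [D] the identity, and [step] advances [l] by up to a length
   [h] independent of [l]. *)
pose G (l : R) := exists2 D : R[i] -> R[i], unif_cont_on A D &
    forall c, A c -> fit c k (D c) = (l%:C)%C * fit c k.+1 0.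
have nl l c : A c -> 0 <= l -> normc ((l%:C)%C * fit c k.+1 0) = 8 * l.
  by move=> Ac l0; rewrite normcM normcR Ac ger0_norm // mulrC.
have Bz c z l : A c -> 0 <= l <= T -> fit c k z = (l%:C)%C * fit c k.+1 0 -> normc z <= B.
  move=> Ac /andP[l0 lT] hz; apply: (fit_bounded_arg d2 (Ac4 c Ac) (k := k)).
    by rewrite /B; lra.
  by rewrite hz nl // /B; lra.
have eN e : 0 < e -> 0 < e ^+ N :> R by move=> e0; rewrite exprn_gt0.
have e4 : 0 < eta / 4 by lra.
pose h := (eta / 4) ^+ N / 9.
have h0 : 0 < h by rewrite divr_gt0 // eN.
have step l l' : G l -> 1 <= l -> l <= l' <= T -> l' - l <= h -> G l'.
  move=> [D Dc Dl] l1 /andP[ll' l'T] llh.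
  have ex c : exists z, A c -> fit c k z = (l'%:C)%C * fit c k.+1 0 /\ normc (D c - z) < eta / 4.
    have [Ac|nAc] := pselect (A c); last by exists 0.
    have [|z hz] := root_near c (D c) ((l'%:C)%C * fit c k.+1 0) (eta / 4) (ltW e4).
      rewrite Dl // -mulrBl -rmorphB normcM normcR Ac distrC ger0_norm; last by lra.
      apply: le_lt_trans (_ : h * 8 < _); first by rewrite ler_pM2r.
      have := eN _ e4; rewrite /h => ?; lra.
    by exists z.
  have [D' hD'] := choice ex.
  exists D'; last by move=> c Ac; have [] := hD' c Ac.
  move=> e e0.
  pose m := Num.min e (eta / 4).
  have m0 : 0 < m by rewrite lt_min e0.
  have [r r0 hr] := Dc _ e4.
  have [K K0 hK] := fit_lipschitz d k.+1 B0.
  pose W := L + l' * K + 1.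
  have l'K0 : 0 <= l' * K by rewrite mulr_ge0 //; lra.
  have W0 : 0 < W by rewrite /W; lra.
  exists (Num.min r (m ^+ N / W)); first by rewrite lt_min r0 divr_gt0 // eN.
  move=> c c' Ac Ac'; rewrite lt_min => /andP[cr cm].
  have [f1 n1] := hD' c Ac; have [f2 n2] := hD' c' Ac'.
  have cB := le_trans (Ac4 _ Ac) B4; have cB' := le_trans (Ac4 _ Ac') B4.
  have l'0T : 0 <= l' <= T by apply/andP; split; lra.
  have D'B := Bz _ _ _ Ac l'0T f1; have D'B' := Bz _ _ _ Ac' l'0T f2.
  have [|z [z1 z2]] := root_near c (D' c') ((l'%:C)%C * fit c k.+1 0) m (ltW m0).
    apply: le_lt_trans (normc_dist _ (fit c' k (D' c')) _) _.
    have q1 := hL c c' (D' c') (D' c') cB cB' D'B' D'B'.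
    have q2 := hK c' c 0 0 cB' cB.
    rewrite normc0E in q2; have {}q2 := q2 B0 B0.
    rewrite subrr normc0E addr0 in q1; rewrite subrr normc0E addr0 in q2.
    rewrite f2 -mulrBr [X in _ + X]normcM normcR ger0_norm; last by lra.
    move: cm; rewrite ltr_pdivlMr // => cm; apply: le_lt_trans cm.
    rewrite [normc (c' - c)]normcBC in q2.
    rewrite /W -f2; have := normc_ge0 (c - c').
    have : l' * normc (fit c' k.+1 0 - fit c k.+1 0) <= l' * (K * normc (c - c')).
      by rewrite ler_wpM2l //; lra.
    by move=> ? ?; rewrite mulrDr mulrDr mulr1; nra.
  move: z2; rewrite lt_min => /andP[z2e z2].
  (* Both have the same image under [fit c k]. The path from [D' c] to [z] through [D c], [D c'] and
     [D' c'] has four legs shorter than [eta / 4], so local injectivity applies. *)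
  have -> : D' c = z.
    apply: (hinj c) => //.
    - by move=> j; exact: Ale.
    - exact: Ac4.
    - exact: Bz Ac l'0T z1.
    - by rewrite f1 nl //; lra.
    - by rewrite f1 z1.
    have := hr _ _ Ac Ac' cr.
    have := normc_dist (D' c) (D c) z; rewrite (normcBC (D' c) (D c)).
    have := normc_dist (D c) (D c') z.
    have := normc_dist (D c') (D' c') z; lra.
  by rewrite normcBC.
have G1 : G 1.
  exists id; first by move=> e e0; exists e.
  by move=> c _; rewrite mul1r fit0S.
have hT : 0 <= (T - 1) / h by rewrite divr_ge0 //; lra.
pose m := (Num.bound ((T - 1) / h)).+1.
have m0 : 0 < m%:R :> R by rewrite ltr0n.
have mh : (T - 1) / m%:R <= h.
  rewrite ler_pdivrMr // mulrC -ler_pdivrMr //.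
  apply: le_trans (ltW (archi_boundP hT)) _.
  by rewrite ler_nat.
set q := (T - 1) / m%:R in mh.
have q0 : 0 <= q by rewrite divr_ge0 //; lra.
have mq : m%:R * q = T - 1 by rewrite mulrC divfK ?gt_eqF.
have Gi i : (i <= m)%N -> G (1 + i%:R * q).
  elim: i => [|i IH] im; first by rewrite mul0r addr0.
  have : i.+1%:R * q <= m%:R * q by rewrite ler_wpM2r // ler_nat.
  have : 0 <= i%:R * q by rewrite mulr_ge0.
  rewrite mq -natr1 mulrDl mul1r => iq0 iT.
  by apply: step (IH (ltnW im)) _ _ _; [|apply/andP; split|]; lra.
by have := Gi m (leqnn _); rewrite mq addrC subrK.
Qed.

End PushOut.

(** * Primitive roots of unity as powers of small rotations *)

Section UnityRoots.
Variable R : realType.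
Implicit Types (z w : R[i]).

Lemma prim_root_exists n : (0 < n)%N -> exists z : R[i], n.-primitive_root z.
Proof.
move=> n0; have [r rE] := closed_field_poly_normal ('X^n - 1 : {poly R[i]}).
move: rE; rewrite (monicP _) ?monicXnsubC // scale1r => rE.
have rn : all n.-unity_root r by apply/allP => z; rewrite -root_prod_XsubC -rE.
have sr : (n < (size r).+1)%N by rewrite -(size_prod_XsubC r id) -rE size_XnsubC.
have [|z _ zP] := hasP (has_prim_root n0 rn _ sr); last by exists z.
by rewrite -separable_prod_XsubC -rE separable_Xn_sub_1 // pnatr_eq0 -lt0n.
Qed.

(** For the square root with nonnegative real part, [normc (u + 1) ^+ 2 >= 2 >= (4 / 3) ^+ 2]; and
    [w - 1 = (u - 1) * (u + 1)]. *)
Lemma sqrt_closer_to1 w : normc w = 1 ->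
  exists u, [/\ u ^+ 2 = w, normc u = 1 & normc (u - 1) <= 3 / 4 * normc (w - 1)].
Proof.
move=> w1.
have [u uw u0] : exists2 u, u ^+ 2 = w & 0 <= complex.Re u.
  have [h|h] := lerP 0 (complex.Re (sqrtc w)); first by exists (sqrtc w); rewrite ?sqr_sqrtc.
  by exists (- sqrtc w); rewrite ?sqrrN ?sqr_sqrtc // raddfN /= oppr_ge0 ltW.
have u1 : normc u = 1.
  by apply/eqP; rewrite -(@eqrXn2 _ 2) ?normc_ge0 // -normcX uw w1 expr1n.
exists u; split => //.
have : 4 / 3 <= normc (u + 1).
  rewrite -(@ler_pXn2r _ 2) ?nnegrE ?normc_ge0 //; last by lra.
  move: u1 u0; case: u {uw} => a b /= h a0.
  have : Num.sqrt (a ^+ 2 + b ^+ 2) ^+ 2 = 1 by rewrite h expr1n.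
  rewrite sqr_sqrtr ?addr_ge0 ?sqr_ge0 // => {}h.
  by rewrite sqr_sqrtr ?addr_ge0 ?sqr_ge0 //; nra.
have -> : w - 1 = (u - 1) * (u + 1) by rewrite -uw; ring.
rewrite normcM; have := normc_ge0 (u - 1); nra.
Qed.

(** Repeated square roots of a primitive root give rotations by arbitrarily small angles. *)
Lemma prim_root_iterated_sqrt n (e : R) : (0 < n)%N -> 0 < e ->
  exists j w, [/\ normc w = 1, normc (w - 1) < e & n.-primitive_root (w ^+ (2 ^ j))].
Proof.
move=> n0 e0; have [z zP] := prim_root_exists n0.
have z1 := normc_root1 n0 (prim_expr_order zP).
(* [1 + j%:R / 3] is the Bernoulli lower bound of [(4 / 3) ^+ j], enough for an Archimedean choice
   of [j]. *)
have H j : exists w, [/\ normc w = 1, w ^+ (2 ^ j) = z &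
    normc (w - 1) * (1 + j%:R / 3) <= normc (z - 1)].
  elim: j => [|j [w [w1 wz hw]]].
    by exists z; rewrite expn0 expr1 mul0r addr0 mulr1.
  have [u [uw u1 hu]] := sqrt_closer_to1 w1.
  exists u; split => //; first by rewrite expnS exprM uw.
  apply: le_trans hw; rewrite -natr1.
  have := normc_ge0 (w - 1); have : 0 <= j%:R :> R by [].
  set x := normc (u - 1) in hu *; set y := normc (w - 1) in hu *; set J := j%:R => J0 y0.
  apply: le_trans (_ : (3 / 4 * y) * (1 + (J + 1) / 3) <= _).
    by rewrite ler_wpM2r //; lra.
  nra.
have q0 : 0 <= normc (z - 1) / e by rewrite divr_ge0 ?normc_ge0 // ltW.
pose j := (3 * Num.bound (normc (z - 1) / e)%R)%N.
have [w [w1 wz hw]] := H j; exists j, w; split => //; last by rewrite wz.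
have := archi_boundP q0; rewrite ltr_pdivrMr // => hj.
rewrite ltNge; apply/negP => ew.
move: hw hj; rewrite natrM; set b := (Num.bound _)%:R => hw hj.
have : 0 <= b by rewrite /b.
nra.
Qed.

Lemma near_unity_root n (y : R[i]) (s : R) : (0 < n)%N -> 0 <= s ->
  normc (y ^+ n - 1) < s ^+ n -> exists2 x, x ^+ n = 1 & normc (y - x) < s.
Proof.
move=> n0 s0 h.
have [|x [hx1 hx2]] := @monic_root_near _ 'X^n n y 1 s (monicXn _ n) (size_polyXn _ n) n0 s0.
  by rewrite hornerXn.
by exists x => //; rewrite -hx1 hornerXn.
Qed.

Lemma unity_root_separated n (x y : R[i]) : (0 < n)%N -> x ^+ n = 1 -> y ^+ n = 1 ->
  normc (x - y) < n%:R^-1 -> x = y.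
Proof.
move=> n0 hx hy h; have y1 := normc_root1 n0 hy.
have yn0 : y != 0 by rewrite -normc_gt0 y1.
have : x / y = 1.
  apply: (@unity_root_near1 _ _ n) => //; first by rewrite expr_div_n hx hy divr1.
  by rewrite -(divff yn0) -mulrBl normcM normcV y1 invr1 mulr1.
by move/(congr1 (fun t => t * y)); rewrite divfK // mul1r.
Qed.

End UnityRoots.

(** * Chain connectedness of the level sets in the parameter plane *)

Section LevelSets.
Variables (R : realType) (d : nat).
Hypothesis d2 : (2 <= d)%N.
Implicit Types (c z w x y v : R[i]) (k n j : nat).
Local Notation fit := (fit d).

(* Far out, [fit c k z] is close to [z ^+ (d ^ k)], so the end point of [push_out]
   provides a continuous approximate [d ^ k]-th root of [fit c k.+1 0]. *)
Lemma push_out_root k (s : R) : (0 < k)%N -> 0 < s ->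
  let A c := normc (fit c k.+1 0) = 8 in
  exists2 D : R[i] -> R[i], unif_cont_on A D &
    forall c, A c -> normc (D c ^+ (d ^ k) - fit c k.+1 0 / 8) < s.
Proof.
move=> k0 s0 A; set N := (d ^ k)%N.
have N0 : (0 < N)%N by rewrite expn_gt0 (ltnW d2).
have [a a0 ha] := fit_asymptotic R d2 k.
have B0 : 0 <= 4 :> R by [].
have [M M0 hM] := fit_bounded d k B0.
have q0 : 0 <= a * 2 ^+ N.-1 by rewrite mulr_ge0 // exprn_ge0.
have qs0 : 0 <= a * 2 ^+ N.-1 / s by rewrite divr_ge0 // ltW.
(* One summand per estimate: 8 gives [T >= 1], [M] excludes [normc Z < 1], [a] gives
   [normc Z <= 2 * t], and the last brings the final error below [s]. *)
pose t := 8 + a + M + a * 2 ^+ N.-1 / s.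
have t8 : 8 <= t by rewrite /t; lra.
have t0 : 0 < t by lra.
have tn0 : (t%:C)%C != 0 :> R[i] by rewrite -normc_gt0 normcR ger0_norm // ltW.
have tN : t <= t ^+ N by rewrite -{1}[t]expr1 ler_weXn2l //; lra.
pose T := t ^+ N / 8.
have T1 : 1 <= T by rewrite /T; lra.
have [D Dc DT] := push_out d2 k0 T1.
exists (fun c => D c / (t%:C)%C).
  move=> e e0; have [r r0 hr] := Dc (e * t) (mulr_gt0 e0 t0).
  exists r => // c c' Ac Ac' cc'; rewrite -mulrBl normcM normcV normcR ger0_norm ?(ltW t0) //.
  by rewrite ltr_pdivrMr // hr.
move=> c Ac; have := DT c Ac; set Z := D c; set P := fit c k.+1 0 => ZE.
have Ac4 : normc c <= 4 by apply: (critical_orbit_param_le4 d2 k0); rewrite Ac.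
have nfit : normc (fit c k Z) = t ^+ N.
  rewrite ZE normcM normcR Ac ger0_norm; last by lra.
  by rewrite /T; lra.
have Z1 : 1 <= normc Z.
  rewrite leNgt; apply/negP => Z1.
  have Z4 : normc Z <= 4 by lra.
  by have := hM c Z Ac4 Z4; rewrite nfit; move: tN; rewrite {1}/t; lra.
have hZ := ha c Z Ac4 Z1; rewrite -/N in hZ.
have rS : normc Z ^+ N = normc Z * normc Z ^+ N.-1 by rewrite -exprS prednK.
have Z2 : normc Z <= 2 * t.
  rewrite leNgt; apply/negP => Z2.
  have h1 := normc_le_dist (Z ^+ N) (fit c k Z).
  rewrite normcBC normcX nfit in h1.
  have h2 : a * normc Z ^+ N.-1 <= normc Z ^+ N / 2.
    rewrite rS mulrAC; apply: ler_wpM2r; first by rewrite exprn_ge0 ?normc_ge0.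
    by rewrite /t in Z2; lra.
  have h3 : (2 * t) ^+ N <= normc Z ^+ N.
    by rewrite lerXn2r // ?nnegrE ?normc_ge0 // ?mulr_ge0 // ltW.
  have h4 : (2 * t) ^+ N < normc Z ^+ N.
    by rewrite ltr_pXn2r ?nnegrE ?normc_ge0 // ?mulr_ge0 ?(ltW t0).
  have h5 : 2 * t ^+ N <= (2 * t) ^+ N.
    by rewrite exprMn ler_pM2r ?exprn_gt0 // -{1}[2]expr1 ler_weXn2l // ler1n.
  lra.
have -> : (Z / t%:C%C) ^+ N - P / 8 = (Z ^+ N - fit c k Z) / (t%:C%C) ^+ N.
  rewrite ZE expr_div_n mulrBl; congr (_ - _).
  rewrite /T rmorphM fmorphV rmorphXn rmorph_nat /=.
  by field; rewrite expf_neq0 //= pnatr_eq0.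
rewrite normcM normcV normcX normcR ger0_norm ?(ltW t0) // normcBC.
rewrite ltr_pdivrMr ?exprn_gt0 //; apply: (le_lt_trans hZ).
apply: le_lt_trans (_ : a * (2 * t) ^+ N.-1 < _).
  by rewrite ler_wpM2l // lerXn2r // ?nnegrE ?normc_ge0 // ?mulr_ge0 // ltW.
have -> : t ^+ N = t * t ^+ N.-1 by rewrite -exprS prednK.
rewrite exprMn mulrA [s * _]mulrA ltr_pM2r ?exprn_gt0 //.
by rewrite [s * t]mulrC -ltr_pdivrMr // /t; lra.
Qed.

Lemma crit_root_near k c v (e : R) : 0 <= e ->
  normc (fit c k.+1 0 - v) < e ^+ (d ^ k) ->
  exists2 c', fit c' k.+1 0 = v & normc (c - c') < e.
Proof.
move=> e0; rewrite fit0S // -horner_cpoly => h; have [mc sc] := cpoly_monic R d2 k.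
have N0 : (0 < d ^ k)%N by rewrite expn_gt0 (ltnW d2).
have [c' [h1 h2]] := monic_root_near mc sc N0 e0 h.
by exists c' => //; rewrite fit0S // -horner_cpoly.
Qed.

(** [cpoly k - v] has degree [d ^ k], so that many distinct roots leave no room for another. *)
Lemma crit_fiber_full k v (u : nat -> R[i]) : 
  (forall i, (i < d ^ k)%N -> fit (u i) k.+1 0 = v) ->
  (forall i j, (i < d ^ k)%N -> (j < d ^ k)%N -> u i = u j -> i = j) ->
  forall c, fit c k.+1 0 = v -> exists2 i, (i < d ^ k)%N & c = u i.
Proof.
move=> uv ui c cv; have [mc sc] := cpoly_monic R d2 k; set N := (d ^ k)%N in uv ui sc *.
have N0 : (0 < N)%N by rewrite expn_gt0 (ltnW d2).
have sp : size (cpoly R d k - v%:P) = N.+1.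
  by rewrite size_polyDl // size_polyN sc ltnS (leq_trans (size_polyC_leq1 _)).
have p0 : cpoly R d k - v%:P != 0 by rewrite -size_poly_eq0 sp.
have rt x : fit x k.+1 0 = v -> root (cpoly R d k - v%:P) x.
  by move=> h; apply/rootP; rewrite hornerD hornerN hornerC horner_cpoly -fit0S // h subrr.
have [/mapP[j]|nc] := boolP (c \in [seq u i | i <- iota 0 N]).
  by rewrite mem_iota add0n => /= jN ->; exists j.
have := max_poly_roots p0 (rs := c :: [seq u i | i <- iota 0 N]).
rewrite sp /= size_map size_iota ltnn nc (rt _ cv) /=.
have -> : all (root (cpoly R d k - v%:P)) [seq u i | i <- iota 0 N].
  apply/allP => x /mapP[j]; rewrite mem_iota add0n => /= jN ->; exact/rt/uv.
rewrite map_inj_in_uniq ?iota_uniq; first by move=> /(_ isT isT).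
by move=> i j; rewrite !mem_iota !add0n => /= iN jN; exact: ui.
Qed.

(** Chains are encoded by the predicates that propagate along them: [S] is connected by steps
    shorter than [e] when each such [phi] holding at one point of [S] holds on all of [S]. *)
Definition eps_uniform (e : R) (S : R[i] -> Prop) (phi : R[i] -> Prop) :=
  forall x y, S x -> S y -> normc (x - y) < e -> phi x -> phi y.

(* Lift the circle of radius 8 to parameters [c_ i] with [fit (c_ i) k.+1 0 = 8 w ^ (i N)].
   The approximate root [D (c_ i)] follows [z w ^ i] for a fixed root of unity [z], so the
   [N] parameters over [8] reached after [0, ..., N - 1] turns are distinct, and they
   exhaust the fiber because [fit _ k.+1 0] has degree [N]. *)
Lemma fiber_uniform k (e : R) phi : (0 < k)%N -> 0 < e ->
  eps_uniform e (fun c => normc (fit c k.+1 0) <= 8) phi ->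
  forall x y, fit x k.+1 0 = 8 -> fit y k.+1 0 = 8 -> phi x -> phi y.
Proof.
move=> k0 e0 hphi x y hx hy phx; set N := (d ^ k)%N.
have N0 : (0 < N)%N by rewrite expn_gt0 (ltnW d2).
have N0R : 0 < N%:R :> R by rewrite ltr0n.
pose A c := normc (fit c k.+1 0) = 8.
(* Distinct [N]-th roots of unity are at least [4 * s = 1 / N] apart. *)
pose s : R := (4 * N%:R)^-1.
have s0 : 0 < s by rewrite invr_gt0 mulr_gt0.
have s1 : s <= 1 / 4.
  by rewrite /s div1r lef_pV2 ?posrE ?mulr_gt0 // ler_peMr // ler1n.
have sN : 4 * s = N%:R^-1 by rewrite /s; field; rewrite gt_eqF.
have sNgt : 0 < s ^+ N by rewrite exprn_gt0.
have [D Dc DN] := push_out_root k0 sNgt; rewrite -/N in DN.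
have [r r0 hr] := Dc s s0.
pose m := Num.min e r.
have m0 : 0 < m by rewrite lt_min e0.
have mN : 0 < m ^+ N by rewrite exprn_gt0.
have N8 : 0 < 8 * N%:R + 1 :> R by lra.
(* The first bound limits the drift from dividing by one more [w], as [normc (D c) <= 2]; the second
   lets a turn by [w ^+ N] at radius 8 lift to a parameter step shorter than [m]. *)
have e1 : 0 < Num.min (s / 2) (m ^+ N / (8 * N%:R + 1)).
  by rewrite lt_min !divr_gt0.
have [l [w [w1 + wP]]] := prim_root_iterated_sqrt N0 e1.
rewrite lt_min => /andP[ws wm].
have wn0 : w != 0 by rewrite -normc_gt0 w1.
have nw i : normc (w ^+ i) = 1 by rewrite normcX w1 expr1n.
have n8 : normc (8 : R[i]) = 8 by rewrite normc_nat.
have ex c : exists c', A c -> fit c' k.+1 0 = w ^+ N * fit c k.+1 0 /\ normc (c - c') < m.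
  have [Ac|nAc] := pselect (A c); last by exists 0.
  have [|c' h1 h2] := @crit_root_near k c (w ^+ N * fit c k.+1 0) m (ltW m0).
    rewrite -{1}[fit _ _ _]mul1r -mulrBl normcM Ac normcBC.
    apply: le_lt_trans (_ : N%:R * normc (w - 1) * 8 < _).
      by rewrite ler_pM2r //; exact: normc_Xsub1.
    move: wm; rewrite ltr_pdivlMr //; have := normc_ge0 (w - 1); lra.
  by exists c'.
have [nxt hn] := choice ex.
pose c_ i := iter i nxt x.
have cE i : fit (c_ i) k.+1 0 = 8 * (w ^+ i) ^+ N /\ A (c_ i).
  elim: i => [|i [IH1 IH2]].
    by rewrite /A -[c_ 0%N]/x hx expr0 expr1n mulr1.
  have [h1 h2] := hn _ IH2; rewrite /A /c_ iterS h1 IH1.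
  split; first by rewrite exprS exprMn; ring.
  by rewrite !normcM normcX w1 expr1n mul1r normcX nw expr1n mulr1.
have cA i : A (c_ i) by have [] := cE i.
have cm i : normc (c_ i - c_ i.+1) < m by have [] := hn _ (cA i).
have cphi i : phi (c_ i).
  elim: i => [|i IH] //; apply: (hphi (c_ i)) IH; rewrite ?cA //.
  by apply: lt_le_trans (cm i) _; rewrite ge_min lexx.
have DN1 c : A c -> normc (D c) <= 2.
  move=> Ac; have h1 := DN c Ac.
  have h2 := normc_le_dist (D c ^+ N) (fit c k.+1 0 / 8).
  have h3 : normc (fit c k.+1 0 / 8) = 1 by rewrite normcM normcV Ac n8 divff ?pnatr_eq0.
  have h4 : s ^+ N <= 1 by rewrite exprn_ile1 //; lra.
  rewrite h3 normcX in h2.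
  have h5 : normc (D c) ^+ N <= 2 ^+ N.
    by apply: le_trans (_ : 2 <= _); [lra | rewrite -{1}[2]expr1 ler_weXn2l // ler1n].
  by rewrite ler_pXn2r ?nnegrE ?normc_ge0 in h5.
have ynear i : exists2 z, z ^+ N = 1 & normc (D (c_ i) / w ^+ i - z) < s.
  apply: near_unity_root => //; first exact: ltW.
  have := DN _ (cA i); have [-> _] := cE i.
  rewrite mulrAC divff ?pnatr_eq0 // mul1r => h.
  have -> : (D (c_ i) / w ^+ i) ^+ N - 1 = (D (c_ i) ^+ N - (w ^+ i) ^+ N) / (w ^+ i) ^+ N.
    by rewrite expr_div_n mulrBl divff // !expf_neq0.
  by rewrite normcM normcV [normc ((w ^+ i) ^+ N)]normcX nw expr1n invr1 mulr1.
have ystep i : normc (D (c_ i) / w ^+ i - D (c_ i.+1) / w ^+ i.+1) < 2 * s.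
  have -> : D (c_ i) / w ^+ i - D (c_ i.+1) / w ^+ i.+1 =
     (D (c_ i) - D (c_ i.+1)) / w ^+ i + D (c_ i.+1) * (w - 1) / w ^+ i.+1.
    by rewrite exprS; field; rewrite wn0 expf_neq0.
  apply: le_lt_trans (normcD _ _) _; rewrite !normcM !normcV !nw !invr1 !mulr1.
  have h1 : normc (D (c_ i) - D (c_ i.+1)) < s.
    by apply: hr; [exact: cA|exact: cA|]; apply: lt_le_trans (cm i) _; rewrite ge_min lexx orbT.
  have := DN1 _ (cA i.+1); have := normc_ge0 (w - 1); nra.
have [z zN z0] := ynear 0%N.
(* The nearby root of unity cannot change: a step moves the quotient by less than [2 * s], so [z]
   and [z'] are closer than [s + 2 * s + s = 1 / N]. *)
have yz i : normc (D (c_ i) / w ^+ i - z) < s.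
  elim: i => [|i IH] //.
  have [z' z'N z'0] := ynear i.+1.
  suff -> : z = z' by [].
  apply: (unity_root_separated N0) => //; rewrite -sN.
  have := normc_dist z (D (c_ i) / w ^+ i) z'.
  have := normc_dist (D (c_ i) / w ^+ i) (D (c_ i.+1) / w ^+ i.+1) z'.
  rewrite (normcBC z (_ / _)); have := ystep i; lra.
have z1 := normc_root1 N0 zN.
have Dz i : normc (D (c_ i) - z * w ^+ i) < s.
  have -> : D (c_ i) - z * w ^+ i = (D (c_ i) / w ^+ i - z) * w ^+ i.
    by rewrite mulrBl divfK // expf_neq0.
  by rewrite normcM nw mulr1.
(* The value is back at 8 every [2 ^ l] steps, because [w ^+ (2 ^ l)] is an [N]-th root of unity. *)
have [||i _ ->] := @crit_fiber_full k 8 (fun i => c_ (2 ^ l * i)%N) _ _ y hy => //.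
  move=> i _; have [-> _] := cE (2 ^ l * i)%N.
  by rewrite exprM exprAC (prim_expr_order wP) expr1n mulr1.
move=> i j; rewrite -/N => iN jN cij.
have /eqP : (w ^+ (2 ^ l)) ^+ i = (w ^+ (2 ^ l)) ^+ j.
  apply: (unity_root_separated N0).
  - by rewrite exprAC (prim_expr_order wP) expr1n.
  - by rewrite exprAC (prim_expr_order wP) expr1n.
  (* Equal parameters have equal [D], which puts [z * w ^+ I] and [z * w ^+ J] within [2 * s] of
     each other. *)
  set I := (2 ^ l * i)%N in cij *; set J := (2 ^ l * j)%N in cij *.
  have -> : normc ((w ^+ (2 ^ l)) ^+ i - (w ^+ (2 ^ l)) ^+ j) = normc (z * w ^+ I - z * w ^+ J).
    by rewrite -mulrBr normcM z1 mul1r -!exprM.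
  have := Dz I; have := Dz J; rewrite cij -sN.
  have := normc_dist (z * w ^+ I) (D (c_ J)) (z * w ^+ J).
  rewrite (normcBC (z * w ^+ I) (D (c_ J))); lra.
by rewrite (eq_prim_root_expr wP) !modn_small // => /eqP.
Qed.

(** Lift the segment from [fit x k.+1 0] to 8 in [m] steps: by convexity it stays in the disc of
    radius 8, and its length is at most 16. *)
Lemma fiber_reached k (e : R) phi : 0 < e ->
  eps_uniform e (fun c => normc (fit c k.+1 0) <= 8) phi ->
  forall x, normc (fit x k.+1 0) <= 8 -> phi x ->
  exists2 c, fit c k.+1 0 = 8 & phi c.
Proof.
move=> e0 hphi x hx phx; set v := fit x k.+1 0 in hx.
have N0 : (0 < d ^ k)%N by rewrite expn_gt0 (ltnW d2).
have eN : 0 < e ^+ (d ^ k) by rewrite exprn_gt0.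
have n8 : normc (8 : R[i]) = 8 by rewrite normc_nat.
have q0 : 0 <= 16 / e ^+ (d ^ k) by rewrite divr_ge0 // ltW.
pose m := (Num.bound (16 / e ^+ (d ^ k))).+1.
have m0 : 0 < m%:R :> R by rewrite ltr0n.
have hm : 16 / m%:R < e ^+ (d ^ k).
  rewrite ltr_pdivrMr // mulrC -ltr_pdivrMr //.
  by apply: lt_le_trans (archi_boundP q0) _; rewrite ler_nat.
pose q (i : nat) : R := i%:R / m%:R.
pose p i : R[i] := v + (q i)%:C%C * (8 - v).
have q01 i : (i <= m)%N -> 0 <= q i <= 1.
  by move=> im; rewrite divr_ge0 //= ler_pdivrMr // mul1r ler_nat.
have p8 i : (i <= m)%N -> normc (p i) <= 8.
  move=> /q01 /andP[h0 h1].
  have -> : p i = (1 - q i)%:C%C * v + (q i)%:C%C * 8.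
    by rewrite /p rmorphB rmorph1; ring.
  apply: le_trans (normcD _ _) _; rewrite !normcM !normcR n8 !ger0_norm //; last by lra.
  by have := normc_ge0 v; nra.
have H i : (i <= m)%N -> exists2 c, fit c k.+1 0 = p i & phi c.
  elim: i => [|i IH] im; first by exists x; rewrite // /p /q mul0r rmorph0 mul0r addr0.
  have [c cp phc] := IH (ltnW im).
  have [|c' h1 h2] := @crit_root_near k c (p i.+1) e (ltW e0).
    apply: le_lt_trans hm; rewrite cp.
    have -> : p i - p i.+1 = - ((m%:R^-1)%:C%C * (8 - v)).
      by rewrite /p /q -[i.+1%:R]natr1 mulrDl rmorphD /= mul1r; ring.
    rewrite (@normcN R) normcM normcR ger0_norm ?invr_ge0 // mulrC ler_pM2r ?invr_gt0 //.
    by apply: le_trans (normcD _ _) _; rewrite (@normcN R) n8; lra.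
  exists c' => //; apply: (hphi c) => //; first by rewrite cp p8 // ltnW.
  by rewrite h1 p8.
have [c h1 h2] := H m (leqnn m); exists c => //.
by rewrite h1 /p /q divff ?gt_eqF // rmorph1 mul1r; ring.
Qed.

(** The negation of [phi] propagates too. If [phi] held at [x] and failed at [y], both facts would
    be carried to the fiber over 8, against [fiber_uniform]. *)
Lemma level_set_uniform k (e : R) phi : (0 < k)%N -> 0 < e ->
  let K c := normc (fit c k.+1 0) <= 8 in
  eps_uniform e K phi -> forall x y, K x -> K y -> phi x -> phi y.
Proof.
move=> k0 e0 K hphi x y Kx Ky phx; apply: contrapT => nphy.
have [c c8 phc] := fiber_reached e0 hphi Kx phx.
have [|c' c'8] := @fiber_reached k e (fun c => ~ phi c) e0 _ y Ky nphy.
  by move=> a b Ka Kb ab na phb; apply: na; apply: (hphi b) => //; rewrite normcBC.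
by apply; exact: (fiber_uniform k0 e0 hphi c8 c'8).
Qed.

End LevelSets.

(** * Cluster points of bounded complex sequences *)

Section BoundedSequences.
Variable R : realType.

Lemma bounded_seq_cvg_sub (u : nat -> R) (B : R) : (forall n, `|u n| <= B) ->
  exists f l, (forall n, (n <= f n)%N) /\
    forall e : R, 0 < e -> exists N, forall n, (N <= n)%N -> `|l - u (f n)| < e.
Proof.
move=> uB; have [|f fi fc] := @bolzano_weierstrass R u.
  by exists B; split; [exact: num_real | move=> x Bx n _; exact: le_trans (uB n) (ltW Bx)].
exists f, (limn (u \o f)); split.
  elim=> [//|n IH]; apply: (leq_ltn_trans IH).
  by rewrite ltnNge -[(_ <= _)%N]/((f n.+1 <= f n)%O) fi ltnn.
move=> e e0; move/cvgrPdist_lt: fc => /(_ e e0) [N _ hN].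
by exists N => n Nn; exact: hN.
Qed.

Lemma bounded_seq_cluster (u : nat -> R[i]) (B : R) : (forall n, normc (u n) <= B) ->
  exists p : R[i], forall (e : R) N, 0 < e -> exists2 n, (N <= n)%N & normc (u n - p) < e.
Proof.
move=> uB.
have [|f [a [fn fa]]] := @bounded_seq_cvg_sub (fun n => complex.Re (u n)) B.
  by move=> n; apply: le_trans (uB n); have [] := normc_ge_Re_Im (u n).
have [|g [b [gn gb]]] := @bounded_seq_cvg_sub (fun n => complex.Im (u (f n))) B.
  by move=> n; apply: le_trans (uB (f n)); have [] := normc_ge_Re_Im (u (f n)).
exists (a +i* b)%C => e N e0; have e2 : 0 < e / 2 by lra.
have [Na ha] := fa _ e2; have [Nb hb] := gb _ e2.
pose n := maxn N (maxn Na Nb); exists (f (g n)).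
  by apply: leq_trans (fn _); apply: leq_trans (gn _); rewrite leq_maxl.
apply: le_lt_trans (normc_le_ReIm _) _.
have h1 : `|complex.Re (u (f (g n)) - (a +i* b)%C)| < e / 2.
  have := ha (g n); rewrite distrC; case: (u _) => x y /=; apply.
  by apply: leq_trans (gn n); rewrite !leq_max leqnn orbT.
have h2 : `|complex.Im (u (f (g n)) - (a +i* b)%C)| < e / 2.
  have := hb n; rewrite distrC; case: (u _) => x y /=; apply.
  by rewrite !leq_max leqnn !orbT.
lra.
Qed.

End BoundedSequences.

(** * Connectedness of the complex Multibrot set *)

Section ConnectedLocus.
Variables (R : realType) (d : nat).
Hypothesis d2 : (2 <= d)%N.
Implicit Types (c z w x y v : R[i]) (k n j : nat).
Local Notation fit := (fit d).

Definition mandel c := exists B : R, forall n, normc (fit c n 0) <= B.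

(** A bounded critical orbit stays within 4; conversely, an iterate is bounded by 4 as soon as its
    successor is bounded by 8. *)
Lemma mandelP c : mandel c <-> forall k, (0 < k)%N -> normc (fit c k.+1 0) <= 8.
Proof.
split=> [[B hB] k _|h].
  by apply: le_trans (critical_orbit_bounded d2 hB _) _; rewrite ler_nat.
exists 4 => -[|n]; first by rewrite normc0E.
by apply: (critical_orbit_le4 d2 (n := n.+2)); [exact: leqnn | exact: h].
Qed.

Lemma level_set_decr c k k' : (0 < k)%N -> (k <= k')%N ->
  normc (fit c k'.+1 0) <= 8 -> normc (fit c k.+1 0) <= 8.
Proof.
move=> k0; rewrite leq_eqVlt => /orP[/eqP -> //|kk'] h.
apply: le_trans (_ : 4 <= 8); last by rewrite ler_nat.
by apply: (critical_orbit_le4 d2 _ h); rewrite ltnS.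
Qed.

(** The level sets decrease: if [p] were outside the [k]-th one, the Lipschitz bound would put some
    [u m] with [m >= k] outside it too. *)
Lemma mandel_cluster (u : nat -> R[i]) p :
  (forall m, normc (fit (u m) m.+2 0) <= 8) ->
  (forall (e : R) N, 0 < e -> exists2 m, (N <= m)%N & normc (u m - p) < e) ->
  mandel p.
Proof.
move=> uK up; apply/mandelP => k k0.
have u4 m : normc (u m) <= 4 by exact: (critical_orbit_param_le4 d2 _ (uK m)).
have p5 : normc p <= 5.
  have [m _ hm] := up 1 0%N ltr01.
  by have := normc_le_dist p (u m); rewrite normcBC; have := u4 m; lra.
have B0 : 0 <= 5 :> R by [].
have [L L0 hL] := fit_lipschitz d k.+1 B0.
rewrite leNgt; apply/negP => h8.
have e0 : 0 < (normc (fit p k.+1 0) - 8) / (L + 1) by rewrite divr_gt0 //; lra.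
have [m km] := up _ k e0; rewrite ltr_pdivlMr; last by lra.
have u5 : normc (u m) <= 5 by have := u4 m; lra.
have := hL p (u m) 0 0 p5 u5; rewrite normc0E => /(_ B0 B0).
rewrite subrr normc0E addr0 normcBC [normc (p - _)]normcBC.
have := normc_le_dist (fit p k.+1 0) (fit (u m) k.+1 0).
rewrite normcBC.
have := level_set_decr k0 (leq_trans km (leqnSn m)) (uK m).
have := normc_ge0 (u m - p); nra.
Qed.

Definition norm_open (U : R[i] -> Prop) :=
  forall x, U x -> exists2 e : R, 0 < e & forall y, normc (y - x) < e -> U y.

(** By chain connectedness each level set contains a short jump out of [W U]. The jumps accumulate
    at a point [p] of [mandel], which can lie neither in [U] nor in [V]. *)
Theorem mandel_connected (U V : R[i] -> Prop) : norm_open U -> norm_open V ->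
  (forall x, mandel x -> U x \/ V x) -> (forall x, mandel x -> U x -> V x -> False) ->
  forall x y, mandel x -> mandel y -> U x -> V y -> False.
Proof.
move=> oU oV cov dis x y Mx My Ux Vy.
(* [U] and [V] may overlap outside [mandel]: shrink them to disjoint sets. *)
pose W (U : R[i] -> Prop) z := exists a (r : R), [/\ mandel a, 0 < r,
  forall b, normc (b - a) < 2 * r -> U b & normc (z - a) < r].
have Wopen A a : norm_open A -> mandel a -> A a ->
    exists2 r : R, 0 < r & forall z, normc (z - a) < r -> W A z.
  move=> oA Ma Aa; have [r r0 hr] := oA a Aa; exists (r / 2); first by lra.
  move=> z za; exists a, (r / 2); split => //; first by lra.
  by move=> b; rewrite mulrC divfK ?pnatr_eq0 //; exact: hr.
have Wself A a : norm_open A -> mandel a -> A a -> W A a.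
  by move=> oA Ma Aa; have [r r0 hr] := Wopen A a oA Ma Aa; apply: hr; rewrite subrr normc0E.
have Wdis z : W U z -> W V z -> False.
  move=> [a [r [Ma r0 ha za]]] [b [s [Mb s0 hb zb]]].
  have ab : normc (a - b) < r + s.
    by have := normc_dist a z b; rewrite (normcBC a z); lra.
  (* The centre of the smaller disc lies in the doubled larger one, hence in both [U] and [V]. *)
  have [rs|sr] := lerP r s.
    apply: (dis a Ma); first by apply: ha; rewrite subrr normc0E; lra.
    by apply: hb; lra.
  apply: (dis b Mb); last by apply: hb; rewrite subrr normc0E; lra.
  by apply: ha; rewrite normcBC; lra.
have ex m : exists u : R[i] * R[i], [/\ normc (fit u.1 m.+2 0) <= 8,
    normc (fit u.2 m.+2 0) <= 8, normc (u.1 - u.2) < m.+1%:R^-1, W U u.1 & ~ W U u.2].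
  apply: contrapT => nex.
  have e0 : 0 < m.+1%:R^-1 :> R by rewrite invr_gt0 ltr0n.
  apply: (Wdis y); last exact: Wself.
  apply: (@level_set_uniform R d d2 m.+1 m.+1%:R^-1 (W U) _ e0 _ x y) => //.
  - move=> a b Ka Kb ab Wa; apply: contrapT => Wb.
    by apply: nex; exists (a, b).
  - exact: (proj1 (mandelP x) Mx).
  - exact: (proj1 (mandelP y) My).
  - exact: Wself.
have [u hu] := choice ex.
have u1K m : normc (fit (u m).1 m.+2 0) <= 8 by have [] := hu m.
have u4 m : normc (u m).1 <= 4 by exact: (critical_orbit_param_le4 d2 _ (u1K m)).
have [p hp] := bounded_seq_cluster u4.
have Mp := mandel_cluster u1K hp.
(* For [p] in [U], both ends of a late jump fall in [W U]; for [p] in [V], the first end falls in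
   [W U] and [W V] at once. *)
have [Up|Vp] := cov p Mp.
  have [r r0 hr] := Wopen U p oU Mp Up; have r2 : 0 < r / 2 by lra.
  have q0 : 0 <= 2 / r by rewrite divr_ge0 // ltW.
  have [m Nm um] := hp _ (Num.bound (2 / r)) r2.
  have [_ _ uu _] := hu m; apply; apply: hr.
  have mr : m.+1%:R^-1 < r / 2.
    rewrite -[r / 2]invrK ltf_pV2 ?posrE ?invr_gt0 ?ltr0n // invf_div.
    by apply: lt_le_trans (archi_boundP q0) _; rewrite ler_nat ltnW.
  apply: le_lt_trans (normc_dist _ (u m).1 _) _.
  by rewrite normcBC [r]splitr ltrD // (lt_trans uu).
have [r r0 hr] := Wopen V p oV Mp Vp.
have [m _ um] := hp _ 0%N r0.
by have [_ _ _ Wu _] := hu m; apply: (Wdis (u m).1 Wu); exact: hr.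
Qed.

End ConnectedLocus.


(** * Splitting the tricomplex numbers into four complex coordinates *)

Section Tricomplex.
Local Notation R := Rdefinitions.R.
Implicit Types (x y : TC) (u v : bool * bool -> R[i]).

Definition sg (b : bool) : R := if b then -1 else 1.

(* The ring morphism [M(3) -> C] sending [i1] to [i], [i2] to [sg s.1 * i] and
   [i3] to [sg s.2 * i]. The four of them identify [M(3)] with [C^4]. *)
Definition tcproj (s : bool * bool) x : R[i] :=
  let: (((a0, a1), (b0, b1)), ((c0, c1), (e0, e1))) := x in
  Complex (a0 - sg s.1 * b1 - sg s.2 * c1 - sg s.1 * sg s.2 * e0)
          (a1 + sg s.1 * b0 + sg s.2 * c0 - sg s.1 * sg s.2 * e1).

(** Inverts the four [tcproj] by orthogonality of the sign characters. The minus signs occur at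
    [j1], [j2], [j3] and [i4], whose images contain the square of [i]. *)
Definition tcunproj u : TC :=
  let avg (f : bool -> bool -> R) :=
    (f false false + f false true + f true false + f true true) / 4 in
  let re s t := complex.Re (u (s, t)) in let im s t := complex.Im (u (s, t)) in
  (((avg re, avg im),
    (avg (fun s t => sg s * im s t), - avg (fun s t => sg s * re s t))),
   ((avg (fun s t => sg t * im s t), - avg (fun s t => sg t * re s t)),
    (- avg (fun s t => sg s * sg t * re s t), - avg (fun s t => sg s * sg t * im s t)))).

Lemma tcprojK x : tcunproj (fun s => tcproj s x) = x.
Proof.
case: x => [[[a0 a1] [b0 b1]] [[c0 c1] [e0 e1]]].
by rewrite /tcunproj /=; do ![congr (_, _)]; field.
Qed.

Lemma tcunprojK u s : tcproj s (tcunproj u) = u s.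
Proof.
apply/eqP; rewrite eq_complex /tcproj /=.
case: s => [[] []]; rewrite /sg /=.
all: case: (u (false, false)) => r1 m1; case: (u (false, true)) => r2 m2.
all: case: (u (true, false)) => r3 m3; case: (u (true, true)) => r4 m4 /=.
all: by apply/andP; split; apply/eqP; field.
Qed.

Lemma tcprojD s x y : tcproj s (tcadd x y) = tcproj s x + tcproj s y.
Proof.
case: x y => [[[a0 a1] [b0 b1]] [[c0 c1] [e0 e1]]] [[[a0' a1'] [b0' b1']] [[c0' c1'] [e0' e1']]].
by apply/eqP; rewrite eq_complex /= !RealsE; apply/andP; split; apply/eqP; ring.
Qed.

Lemma tcprojN s x : tcproj s (tcopp x) = - tcproj s x.
Proof.
case: x => [[[a0 a1] [b0 b1]] [[c0 c1] [e0 e1]]].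
by apply/eqP; rewrite eq_complex /= !RealsE; apply/andP; split; apply/eqP; ring.
Qed.

Lemma tcprojM s x y : tcproj s (tcmul x y) = tcproj s x * tcproj s y.
Proof.
case: x y => [[[a0 a1] [b0 b1]] [[c0 c1] [e0 e1]]] [[[a0' a1'] [b0' b1']] [[c0' c1'] [e0' e1']]].
case: s => s t; apply/eqP; rewrite eq_complex /= !RealsE.
by case: s; case: t => /=; apply/andP; split; apply/eqP; ring.
Qed.

Lemma tcproj0 s : tcproj s tc0 = 0.
Proof. by apply/eqP; rewrite eq_complex /= !RealsE !mulr0 !(addr0, subr0) !eqxx. Qed.

Lemma tcproj1 s : tcproj s tc1 = 1.
Proof. by apply/eqP; rewrite eq_complex /= !RealsE !mulr0 !(addr0, subr0) !eqxx. Qed.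

Lemma tcprojX s x n : tcproj s (tcpow x n) = tcproj s x ^+ n.
Proof. by elim: n => [|n IH]; rewrite ?tcproj1 // exprS -IH -tcprojM. Qed.

Lemma tcproj_Qiter s (p : nat) x m :
  tcproj s (Qiter p x m) = fit p (tcproj s x) m 0.
Proof.
elim: m => [|m IH]; first exact: tcproj0.
rewrite fitS -IH -[Qiter p x m.+1]/(tcadd (tcpow (Qiter p x m) p) x) tcprojD.
by rewrite tcprojX.
Qed.

Lemma tcnorm_ge0 x : 0 <= tcnorm x.
Proof. by apply/RleP; exact: R_sqrt.sqrt_pos. Qed.

(** Parseval's identity for the four sign characters. *)
Lemma sqr_tcnorm x : 4 * tcnorm x ^+ 2 =
  normc (tcproj (false, false) x) ^+ 2 + normc (tcproj (false, true) x) ^+ 2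
  + normc (tcproj (true, false) x) ^+ 2 + normc (tcproj (true, true) x) ^+ 2.
Proof.
case: x => [[[a0 a1] [b0 b1]] [[c0 c1] [e0 e1]]].
rewrite /tcnorm /dnorm2 /bcnorm2 /dnorm2 /cnorm2 /dnorm2 /= !RealsE.
rewrite !sqr_sqrtr ?addr_ge0 ?sqr_ge0 -?expr2 ?sqr_ge0 //.
by rewrite /sg; ring.
Qed.

Lemma normc_tcproj_le s x : normc (tcproj s x) <= 2 * tcnorm x.
Proof.
rewrite -(@ler_pXn2r _ 2) ?nnegrE ?normc_ge0 ?mulr_ge0 ?tcnorm_ge0 //.
rewrite exprMn (_ : 2 ^+ 2 = 4); last by ring.
rewrite sqr_tcnorm.
have h t := sqr_ge0 (normc (tcproj t x)).
have := h (false, false); have := h (false, true).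
have := h (true, false); have := h (true, true).
by case: s => [[] []]; lra.
Qed.

Lemma tcnorm_le x (B : R) : (forall s, normc (tcproj s x) <= B) -> tcnorm x <= B.
Proof.
move=> h; have B0 := le_trans (normc_ge0 _) (h (true, true)).
rewrite -(@ler_pXn2r _ 2) ?nnegrE ?tcnorm_ge0 //.
rewrite -(ler_pM2l (x := 4)) // sqr_tcnorm.
have h2 s : normc (tcproj s x) ^+ 2 <= B ^+ 2.
  by rewrite ler_pXn2r ?nnegrE ?normc_ge0.
have := h2 (false, false); have := h2 (false, true).
have := h2 (true, false); have := h2 (true, true); lra.
Qed.

(** The projections are ring morphisms, so they send orbits to orbits, and the norm comparisons
    transfer boundedness both ways. *)
Lemma Multibrot3P (p : nat) x : Multibrot3 p x <-> forall s, mandel p (tcproj s x).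
Proof.
split=> [[M hM] s|h].
  have M0 : 0 <= M by apply: le_trans (tcnorm_ge0 (Qiter p x 1)) _; apply/RleP/hM.
  exists (2 * M) => -[|n]; first by rewrite normc0E mulr_ge0.
  rewrite -tcproj_Qiter; apply: le_trans (normc_tcproj_le _ _) _.
  by rewrite ler_pM2l //; apply/RleP/hM/PeanoNat.Nat.lt_0_succ.
have [B hB] := choice h.
(* Summing the nonnegative parts gives a single bound for the four coordinates. *)
exists (\sum_s Num.max 0 (B s)) => m _; apply/RleP/tcnorm_le => s.
rewrite tcproj_Qiter; apply: (le_trans (hB s m)).
rewrite (bigD1 s) //= ler_wpDr ?le_max ?lexx ?orbT //.
by apply: sumr_ge0 => t _; rewrite le_max lexx.
Qed.

Definition set_coord u i z : bool * bool -> R[i] := fun j => if j == i then z else u j.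

Lemma tcdist_set_coord u i z z' :
  tcdist (tcunproj (set_coord u i z')) (tcunproj (set_coord u i z)) <= normc (z' - z).
Proof.
apply: tcnorm_le => s; rewrite tcprojD tcprojN !tcunprojK /set_coord.
by case: ifP => _ //; rewrite subrr normc0E normc_ge0.
Qed.

(** As for a product of connected sets: the coordinates of [x] are replaced by those of [y] one at a
    time. Each slice is a copy of the complex set, so no replacement leaves [U]. *)
Lemma Multibrot3_connected (p : nat) : (2 <= p)%N -> tc_connected (Multibrot3 p).
Proof.
move=> p2 [U [V [oU [oV [cov [[x [Sx Ux]] [[y [Sy Vy]] dis]]]]]]].
have open_coord (A : TC -> Prop) u i : tc_open A ->
    norm_open (fun z => A (tcunproj (set_coord u i z))).
  move=> oA z Az; have [e [e0 he]] := oA _ Az.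
  exists e => [|z' zz']; first exact/RltP.
  apply: he; apply/RltP; apply: le_lt_trans (tcdist_set_coord _ _ _ _) zz'.
have moveU u i b : (forall s, mandel p (u s)) -> mandel p b -> U (tcunproj u) ->
    U (tcunproj (set_coord u i b)).
  move=> Mu Mb Uu.
  have S z : mandel p z -> Multibrot3 p (tcunproj (set_coord u i z)).
    by move=> Mz; apply/Multibrot3P => s; rewrite tcunprojK /set_coord; case: ifP.
  have [//|Vb] := cov _ (S b Mb); exfalso.
  have uE : set_coord u i (u i) = u.
    by apply/funext => s; rewrite /set_coord; case: eqP => // ->.
  apply: (mandel_connected p2 (open_coord U u i oU) (open_coord V u i oV) _ _ (Mu i) Mb _ Vb).
  - by move=> z /S; exact: cov.
  - by move=> z /S; exact: dis.
  - by rewrite uE.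
have /Multibrot3P Mx := Sx; have /Multibrot3P My := Sy.
apply: (dis y Sy _ Vy).
pose u0 s := tcproj s x; pose w s := tcproj s y.
pose u1 := set_coord u0 (false, false) (w (false, false)).
pose u2 := set_coord u1 (false, true) (w (false, true)).
pose u3 := set_coord u2 (true, false) (w (true, false)).
pose u4 := set_coord u3 (true, true) (w (true, true)).
have Mset u i : (forall s, mandel p (u s)) -> forall s, mandel p (set_coord u i (w i) s).
  by move=> Mu s; rewrite /set_coord; case: ifP => _; [exact: My | exact: Mu].
have M0 s : mandel p (u0 s) by exact: Mx.
have M1 s : mandel p (u1 s) by exact: Mset.
have M2 s : mandel p (u2 s) by exact: Mset.
have M3 s : mandel p (u3 s) by exact: Mset.
have U0 : U (tcunproj u0) by rewrite tcprojK.
have U1 : U (tcunproj u1) by apply: moveU U0; [exact: M0 | exact: My].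
have U2 : U (tcunproj u2) by apply: moveU U1; [exact: M1 | exact: My].
have U3 : U (tcunproj u3) by apply: moveU U2; [exact: M2 | exact: My].
have U4 : U (tcunproj u4) by apply: moveU U3; [exact: M3 | exact: My].
suff <- : tcunproj u4 = y by [].
by rewrite -[RHS]tcprojK; congr tcunproj; apply/funext => -[[] []].
Qed.

End Tricomplex.

(* From here on [<=] on [nat] is [le] again. *)
Import Corelib.Init.Peano.

Theorem mainTheorem14 (p : nat) (hp : (2 <= p)%nat) :
  tc_connected (Multibrot3 p).
Proof. by apply: Multibrot3_connected; apply/ssrnat.leP. Qed.
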